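(* Let $f(t)$ be a real polynomial with $\deg(f)\le\tau$ which is nonnegative in $[-1,t_{FL}]$ and increasing in $[t_{FL},1]$. Then for every spherical $\tau$-design $C\subset\mathbb{S}^{n-1}$ we have $$\rho(C)\le m_u,$$ where $m_u$ is the largest root of the equation $n f(t)=f_0|C|$.
   Context: Here $n\ge 2$, $\tau\ge1$ are integers. A finite set $C\subset\mathbb{S}^{n-1}\subset\mathbb{R}^n$ is a spherical $\tau$-design if for every polynomial $f(x_1,\dots,x_n)$ of degree at most $\tau$ the average of $f$ over $C$ equals the average of $f$ over $\mathbb{S}^{n-1}$ with respect to the Lebesgue measure; it is assumed that $C$ spans $\mathbb{R}^n$. $\rho(C):=\min_{y\in\mathbb{S}^{n-1}}\max_{x\in C}\langle x,y\rangle$ (equivalently $\rho(C)=1-r(C)^2/2$, where $r(C)=\max_{y\in\mathbb{S}^{n-1}}\min_{x\in C}d(y,x)$ is the covering radius of $C$ in Euclidean distance $d$). $f_0$ denotes the first (constant) coefficient of the expansion $f=\sum_i f_iP_i^{(n)}$ of $f$ in the Gegenbauer polynomials $P_i^{(n)}$ (of degree $i$, orthogonal on $[-1,1]$ with weight $(1-t^2)^{(n-3)/2}$, normalized by $P_i^{(n)}(1)=1$); equivalently $f_0=c_n\int_{-1}^1f(t)(1-t^2)^{(n-3)/2}dt$ with $c_n=\Gamma(n/2)/(\sqrt{\pi}\,\Gamma((n-1)/2))$. Writing $\tau=2k-1+e$ with $e\in\{0,1\}$, the number $t_{FL}=t_k^{0,e}$ is the largest zero of the Jacobi polynomial $P_k^{(\alpha,\beta)}(t)$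 of degree $k$ with $\alpha=\frac{n-3}{2}$, $\beta=\frac{n-3}{2}+e$.
   Formalization: The formal theorem adds the assumption t_FL ≤ m_u; without it the claim fails, e.g. for f = 2+3t−t³, τ = 3, n = 3 and C the icosahedron, where the only real root of 3f(t) = 24 is below −2; since ρ(C) ≥ t_FL always holds, only false instances are excluded. *)

(* Defs.v *)
From HB Require Import structures.
From mathcomp Require Import all_boot all_order all_algebra finmap.
(* The notations of mpoly clash with those of mathcomp-analysis. *)
From mathcomp.multinomials Require Import -(notations) mpoly.
From mathcomp Require Import all_classical all_reals all_analysis.

Set Implicit Arguments.
Unset Strict Implicit.
Unset Printing Implicit Defensive.

Import Order.TTheory GRing.Theory Num.Theory.
Import numFieldNormedType.Exports.

Local Open Scope classical_set_scope.
Local Open Scope ring_scope.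

(* The norm `|x| that mathcomp-analysis puts on 'rV[R]_n is the sup norm, so
   the Euclidean structure is given by this inner product. *)
Definition dot (R : realType) (n : nat) (x y : 'rV[R]_n) : R :=
  \sum_(i < n) x ord0 i * y ord0 i.

(* The sphere S^(n-1) of R^n. *)
Definition sphere (R : realType) (n : nat) : set 'rV[R]_n :=
  [set x | dot x x = 1].

(* Surface (Lebesgue) integral over S^(n-1) in hyperspherical coordinates:
   for n = p + 1 >= 2, x = (cos phi, sin phi * z) with 0 <= phi <= pi and
   z in S^(p-1), and the area element is (sin phi)^(p-1) dphi dsigma(z).
   S^0 = {1, -1} carries the counting measure.  The case n = 0 is junk. *)
Fixpoint sphere_integral (R : realType) (n : nat) : ('rV[R]_n -> R) -> R :=
  match n return ('rV[R]_n -> R) -> R with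
  | 0 => fun=> 0
  | p.+1 => fun F : 'rV[R]_(1 + p) -> R =>
      if p is q.+1 then
        \int[@lebesgue_measure R]_(phi in `[0, pi])
          (sin phi ^+ q *
           sphere_integral (fun z : 'rV[R]_p =>
             F (row_mx (cos phi)%:M (sin phi *: z))))
      else F (const_mx 1) + F (const_mx (-1))
  end.

Definition sphere_mean (R : realType) (n : nat) (F : 'rV[R]_n -> R) : R :=
  sphere_integral F / sphere_integral (fun _ : 'rV[R]_n => 1).

(* mmeasure mdeg p is msize p, that is 1 + deg p, or 0 for p = 0. *)
Definition spherical_design (R : realType) (n tau : nat)
    (C : {fset 'rV[R]_n}) : Prop :=
  [/\ [set` C] `<=` @sphere R n,
      <<C>>%VS = fullv &
      forall p : mpoly n R, (mmeasure mdeg p <= tau.+1)%N ->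
        (\sum_(x <- C) meval (x ord0) p) / #|` C|%:R =
        sphere_mean (fun x : 'rV[R]_n => meval (x ord0) p)].

(* The minimum over the sphere of the maximum over C: both extrema are
   attained when C is nonempty and n > 0, so inf and sup denote them. *)
Definition rho (R : realType) (n : nat) (C : {fset 'rV[R]_n}) : R :=
  inf [set sup [set dot x y | x in [set` C]] | y in @sphere R n].

(* The powR convention at t = 1 and t = -1 plays no role under the integral. *)
Definition gegenbauer_weight (R : realType) (n : nat) (t : R) : R :=
  (1 - t ^+ 2) `^ ((n%:R - 3) / 2).

(* These three conditions determine the sequence P. *)
Definition gegenbauer (R : realType) (n : nat) (P : nat -> {poly R}) : Prop :=
  [/\ forall i, size (P i) = i.+1,
      forall i, (P i).[1] = 1 &
      forall i j, i != j ->
        \int[@lebesgue_measure R]_(t in `[-1, 1])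
          ((P i).[t] * (P j).[t] * gegenbauer_weight n t) = 0].

(* x (x - 1) ... (x - m + 1) / m! *)
Definition gbinom (R : realType) (x : R) (m : nat) : R :=
  (\prod_(j < m) (x - j%:R)) / m`!%:R.

(* Szego, Orthogonal Polynomials, (4.3.2). *)
Definition jacobi (R : realType) (a b : R) (k : nat) : {poly R} :=
  \sum_(s < k.+1)
    (gbinom (k%:R + a) (k - s) * gbinom (k%:R + b) s) *:
      ((2^-1 *: ('X - 1)) ^+ s * (2^-1 *: ('X + 1)) ^+ (k - s)).

Definition largest_root (R : realType) (p : {poly R}) (r : R) : Prop :=
  root p r /\ forall s, root p s -> s <= r.

(* Main.v *)
Require Import Defs.
From mathcomp Require Import all_boot all_order all_algebra finmap.
From mathcomp.multinomials Require Import -(notations) mpoly.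
From mathcomp Require Import all_classical all_reals all_analysis.
From mathcomp Require Import measurable_realfun.
From mathcomp Require Import ring lra zify.
Import Order.TTheory GRing.Theory Num.Theory.
Import numFieldNormedType.Exports.
Local Open Scope classical_set_scope.
Local Open Scope ring_scope.

(* A vertex z of the polar polytope {z | <x, z> <= 1 for all x in C} gives a
   unit vector y = z / |z| and h = 1 / |z| with <x, y> <= h on C and equality
   for at least n points of C.  The design property applied to f(<x, y>) yields
   sum_(x in C) f(<x, y>) = f_0 |C|, because the spherical mean of a zonal
   polynomial is its normalized Gegenbauer-weighted integral.  All the roots of
   the Jacobi polynomial are at least -1, so f >= 0 on [-1, 1] and the sum is at
   least n f(h).  If h > m_u, monotonicity gives
   n f(h) >= n f(m_u) = f_0 |C|, so h is a root exceeding m_u. *)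

(** * The inner product and the polar polytope *)

Section Dot.
Context {R : realType} {n : nat}.
Implicit Types (x y z : 'rV[R]_n) (a : R).

Lemma dotC x y : dot x y = dot y x.
Proof. by apply: eq_bigr => i _; rewrite mulrC. Qed.

Lemma dotDl x y z : dot (x + y) z = dot x z + dot y z.
Proof.
by rewrite -big_split /=; apply: eq_bigr => i _; rewrite mxE mulrDl.
Qed.

Lemma dotZl a x y : dot (a *: x) y = a * dot x y.
Proof.
by rewrite /dot mulr_sumr; apply: eq_bigr => i _; rewrite mxE mulrA.
Qed.

Lemma dotDr x y z : dot x (y + z) = dot x y + dot x z.
Proof. by rewrite dotC dotDl !(dotC x). Qed.

Lemma dotZr a x y : dot x (a *: y) = a * dot x y.
Proof. by rewrite dotC dotZl dotC. Qed.

Lemma dot0r x : dot x 0 = 0.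
Proof. by rewrite /dot big1// => i _; rewrite mxE mulr0. Qed.

Lemma dot_ge0 x : 0 <= dot x x.
Proof. by apply: sumr_ge0 => i _; exact: sqr_ge0. Qed.

Lemma dot_eq0 x : (dot x x == 0) = (x == 0).
Proof.
apply/eqP/eqP => [|->]; last exact: dot0r.
move=> /psumr_eq0P x0; apply/rowP => i; rewrite mxE.
by apply/eqP; rewrite -sqrf_eq0 expr2 x0// => j _; exact: sqr_ge0.
Qed.

Lemma dot_sphere_le1 x y :
  @sphere R n x -> @sphere R n y -> `|dot x y| <= 1.
Proof.
rewrite /sphere /= => x1 y1; rewrite ler_norml.
(* Expanding the squared norms of [x + y] and [x - y] gives the two bounds. *)
have := dot_ge0 (x + y); have := dot_ge0 (x + (-1) *: y).
rewrite !(dotDl, dotDr, dotZl, dotZr) x1 y1 (dotC y x); lra.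
Qed.

Lemma dot_span_eq0 (T : seq 'rV[R]_n) v :
  (forall x, x \in T -> dot x v = 0) -> forall x, x \in <<T>>%VS -> dot x v = 0.
Proof.
move=> Tv x; rewrite -[T]in_tupleE => /coord_span ->.
rewrite (big_morph (fun z => dot z v) (id1 := 0) (op1 := +%R)); first last.
- by rewrite dotC dot0r.
- by move=> a b; rewrite dotDl.
by apply: big1 => i _; rewrite dotZl Tv ?mulr0// mem_nth.
Qed.

Lemma exists_orthogonal (U : {vspace 'rV[R]_n}) : (\dim U < n)%N ->
  exists2 v, v != 0 & forall x, x \in U -> dot x v = 0.
Proof.
(* The columns of [M] form a basis of [U], so its rank is below [n], and a nonzero row vector in its
   left kernel is orthogonal to [U]. *)
move=> dimU; pose b := vbasis U.
pose M : 'M[R]_(n, \dim U) := \matrix_(i, j) (b`_j) ord0 i.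
have kM : kermx M != 0.
  rewrite -mxrank_eq0 mxrank_ker subn_eq0 -ltnNge.
  exact: leq_ltn_trans (rank_leq_col M) dimU.
have /rowV0Pn[v vM v0] := kM.
exists v => // x; rewrite -(span_basis (vbasisP U)).
apply: dot_span_eq0 => z /(nthP 0)[j]; rewrite size_tuple => jd <-.
move/sub_kermxP/rowP: vM => /(_ (Ordinal jd)); rewrite !mxE => vM.
by rewrite -[RHS]vM; apply: eq_bigr => i _; rewrite !mxE mulrC.
Qed.

Lemma dot_full_eq0 (T : seq 'rV[R]_n) v :
  <<T>>%VS = fullv -> (forall x, x \in T -> dot x v = 0) -> v = 0.
Proof.
move=> TV Tv; apply/eqP; rewrite -dot_eq0; apply/eqP.
by apply: dot_span_eq0 Tv _ _; rewrite TV memvf.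
Qed.

(* A point z of the polar polytope with maximal rank of the set of tight
   constraints is a vertex: along a direction orthogonal to the tight
   constraints one reaches a further one, since the polytope is bounded. *)
Lemma exists_polar_vertex (C : {fset 'rV[R]_n}) :
    <<C>>%VS = fullv -> (forall v, \sum_(x <- C) dot x v = 0) ->
  exists z, (forall x, x \in C -> dot x z <= 1) /\
    <<[seq x <- C | dot x z == 1]>>%VS = fullv.
Proof.
move=> CV C0.
pose tight z := <<[seq x <- C | dot x z == 1]>>%VS.
pose polar z := forall x, x \in C -> dot x z <= 1.
pose Q k := `[< exists2 z, polar z & \dim (tight z) = k >].
have Q0 : exists k, Q k.
  exists (\dim (tight 0)); apply/asboolP; exists 0 => // x _.
  by rewrite dot0r ler01.
have dimV : \dim {:'rV[R]_n} = n by rewrite dimvf /dim /= mul1n.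
have Qn k : Q k -> (k <= n)%N.
  by move=> /asboolP[z _ <-]; rewrite -[leqRHS]dimV dimvS// subvf.
have [k /asboolP[z zP <-] kmax] := ex_maxnP Q0 Qn.
exists z; split=> //; apply/eqP; rewrite eqEdim subvf /= leqNgt dimV.
apply/negP => /exists_orthogonal[v v0 tv].
(* The values [dot x v] add up to zero over [C]. If none were positive, all would vanish, forcing
   [v = 0] because [C] spans. *)
have [x xC xv] : exists2 x, x \in C & 0 < dot x v.
  apply/not_exists2P => Cv; move/eqP: v0; apply.
  apply: (dot_full_eq0 _ _ CV) => x xC; apply/eqP; rewrite -oppr_eq0; apply/eqP.
  have Cv0 : \sum_(y <- C | y \in C) - dot y v == 0.
    by rewrite -big_seq sumrN C0 oppr0.
  move: Cv0; rewrite psumr_eq0 => [/allP/(_ _ xC)/implyP/(_ xC)/eqP//|y yC].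
  by rewrite oppr_ge0 leNgt; apply/negP => yv; case: (Cv y).
(* Moving from [z] along [v], the constraint of [y] becomes tight after [F y] times [v]. The
   smallest such step keeps the point in the polytope. *)
pose F (y : C) := (1 - dot (val y) z) / dot (val y) v.
have [/= y yv ymin] := @arg_minP _ _ _ [` xC]%fset
  (fun y : C => 0 < dot (val y) v) F xv.
have yC : val y \in C := valP y.
have s0 : 0 <= F y by rewrite divr_ge0 ?subr_ge0 ?zP// ltW.
pose z' := z + F y *: v.
have z'P : polar z'.
  move=> w wC; rewrite dotDr dotZr; have [wv|wv] := leP (dot w v) 0.
    by have := zP _ wC; have := mulr_ge0_le0 s0 wv; lra.
  have /= := ymin [` wC]%fset wv; rewrite {2}/F /= ler_pdivlMr//; lra.
have sub : (tight z <= tight z')%VS.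
  apply: sub_span => w; rewrite !mem_filter => /andP[wz wC]; rewrite wC andbT.
  rewrite dotDr dotZr tv ?mulr0 ?addr0//.
  by apply: memv_span; rewrite mem_filter wz.
have yz' : val y \in tight z'.
  apply: memv_span; rewrite mem_filter yC andbT dotDr dotZr /F.
  by rewrite divfK ?(lt0r_neq0 yv)// addrC subrK.
have : (\dim (tight z') <= \dim (tight z))%N.
  by apply: kmax; apply/asboolP; exists z'.
(* The newly tight [val y] lies outside the old span, because [v] is orthogonal to that span while
   [dot (val y) v > 0]. The dimension therefore grows, against maximality. *)
rewrite leqNgt => /negP; apply; rewrite ltn_neqAle dimvS// andbT.
apply: contraTneq yv => dimE; rewrite -leNgt tv//.
suff E : tight z = tight z' by rewrite -/(tight z) E.
by apply/eqP; rewrite eqEdim sub dimE /=.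
Qed.
End Dot.

(** * Roots of Jacobi polynomials *)

Lemma gbinom_gt0 (R : realType) (x : R) (m : nat) :
  m%:R < x + 1 -> 0 < gbinom x m.
Proof.
move=> mx; rewrite divr_gt0 ?ltr0n ?fact_gt0//.
apply: prodr_gt0 => j _; rewrite subr_gt0.
have : (j.+1%:R <= m%:R :> R) by rewrite ler_nat.
by rewrite -natr1; lra.
Qed.

(* To the left of -1 all the terms of the Jacobi sum have the sign (-1) ^ k. *)
Lemma jacobi_root_geN1 (R : realType) (a b : R) (k : nat) (x : R) :
  -1 < a -> -1 < b -> root (jacobi a b k) x -> -1 <= x.
Proof.
move=> a1 b1 /rootP jx; rewrite leNgt; apply/negP => x1.
suff : 0 < (-1) ^+ k * (jacobi a b k).[x] by rewrite jx mulr0 ltxx.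
(* Since [a] and [b] exceed -1, the upper arguments exceed [k - 1], which makes every factor of both
   binomials positive. *)
have A0 (s : nat) : (s <= k)%N ->
    0 < gbinom (k%:R + a) (k - s) * gbinom (k%:R + b) s.
  move=> sk; have sk' : s%:R <= k%:R :> R by rewrite ler_nat.
  by rewrite mulr_gt0 ?gbinom_gt0 ?natrB//; have := ler0n R s; lra.
(* The [k] signs are spread over the [k] linear factors, each of which is negative to the left of
   -1. *)
have E (s : nat) : (s <= k)%N -> (-1) ^+ k *
      ((gbinom (k%:R + a) (k - s) * gbinom (k%:R + b) s) *:
      ((2^-1 *: ('X - 1)) ^+ s * (2^-1 *: ('X + 1)) ^+ (k - s))).[x] =
    gbinom (k%:R + a) (k - s) * gbinom (k%:R + b) s *
      ((1 - x) / 2) ^+ s * ((- 1 - x) / 2) ^+ (k - s).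
  move: (gbinom _ _) (gbinom _ _) => p q sk.
  rewrite -{1}(subnKC sk) exprD !hornerE.
  have -> : (1 - x) / 2 = -1 * (2^-1 * (x - 1)) by ring.
  have -> : (-1 - x) / 2 = -1 * (2^-1 * (x + 1)) by ring.
  by rewrite !exprMn /=; ring.
rewrite horner_sum mulr_sumr big_ord_recr /= ltr_wpDl//.
  apply: sumr_ge0 => s _; have sk := ltnW (ltn_ord s).
  rewrite E// mulr_ge0 ?exprn_ge0//; last lra.
  by rewrite mulr_ge0 ?exprn_ge0 ?(ltW (A0 _ sk))//; lra.
rewrite E// mulr_gt0 ?exprn_gt0//; last lra.
by rewrite mulr_gt0 ?exprn_gt0 ?A0//; lra.
Qed.

(** * Integrals of trigonometric monomials *)

Lemma Rintegral_sum {d} {T : measurableType d} {R : realType}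
    (mu : {measure set T -> \bar R}) (D : set T) (I : Type) (s : seq I)
    (h : I -> T -> R) :
  measurable D -> (forall i, mu.-integrable D (EFin \o h i)) ->
  \int[mu]_(x in D) (\sum_(i <- s) h i x) =
  \sum_(i <- s) \int[mu]_(x in D) h i x.
Proof.
move=> mD ih; elim: s => [|i s IHs].
  rewrite big_nil; under eq_Rintegral do rewrite big_nil.
  by rewrite Rintegral_cst// mul0r.
under eq_Rintegral do rewrite big_cons.
rewrite big_cons -IHs RintegralD//.
have -> : EFin \o (fun x => \sum_(j <- s) h j x) =
          fun x => (\sum_(j <- s) (EFin \o h j) x)%E.
  by apply/funext => x /=; rewrite sumEFin.
exact: integrable_sum.
Qed.

Section TrigMoments.
Context {R : realType}.
Notation mu := (@lebesgue_measure R).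

Lemma continuous_integrable_itv (f : R -> R) (a b : R) :
  continuous f -> mu.-integrable `[a, b] (EFin \o f).
Proof.
move=> cf; apply: continuous_compact_integrable; first exact: segment_compact.
exact: continuous_subspaceT.
Qed.

Lemma Rintegral_is_derive (F f : R -> R) (a b : R) : a < b -> continuous f ->
    (forall x, is_derive (x : R) (1 : R) F (f x)) ->
  \int[mu]_(x in `[a, b]) f x = F b - F a.
Proof.
move=> ab cf dF; have dF' x : derivable F x 1 by [].
have cF : continuous F.
  by move=> x; apply/differentiable_continuous/derivable1_diffP.
rewrite /Rintegral (@continuous_FTC2 _ f F)//.
- exact: continuous_subspaceT.
- by split=> [x _||]; [exact: dF'|apply: cvg_at_right_filter; exact: cF|
                     apply: cvg_at_left_filter; exact: cF].
- by move=> x _; rewrite derive1E derive_val.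
Qed.

Definition trig_moment (a b : nat) : R :=
  \int[mu]_(t in `[0, pi]) (cos t ^+ a * sin t ^+ b).

Lemma continuous_trig (a b : nat) :
  continuous (fun t : R => cos t ^+ a * sin t ^+ b).
Proof.
move=> t; apply: cvgM.
  apply: (@continuous_comp _ _ _ cos (fun x => x ^+ a)).
    exact: continuous_cos.
  exact: exprn_continuous.
apply: (@continuous_comp _ _ _ sin (fun x => x ^+ b)).
  exact: continuous_sin.
exact: exprn_continuous.
Qed.

Lemma continuous_trigZ (c : R) (a b : nat) :
  continuous (fun t : R => c * (cos t ^+ a * sin t ^+ b)).
Proof.
by move=> t; apply: cvgM; [exact: cvg_cst | exact: continuous_trig].
Qed.

(** The difference of the two sides integrates the derivative of [cos t ^+ a.+1 * sin t ^+ b.+1],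
    which vanishes at [0] and at [pi]. *)
Lemma trig_moment_parts (a b : nat) :
  b.+1%:R * trig_moment a.+2 b = a.+1%:R * trig_moment a b.+2.
Proof.
apply/eqP; rewrite -subr_eq0; apply/eqP.
rewrite /trig_moment -!RintegralZl//;
  try exact/continuous_integrable_itv/continuous_trig.
rewrite -RintegralB//; try exact/continuous_integrable_itv/continuous_trigZ.
have dF (x : R) : is_derive x (1 : R) (fun t => cos t ^+ a.+1 * sin t ^+ b.+1)
    (b.+1%:R * (cos x ^+ a.+2 * sin x ^+ b) -
     a.+1%:R * (cos x ^+ a * sin x ^+ b.+2)).
  rewrite [X in is_derive _ _ X](_ : _ =
    ((@cos R) ^+ a.+1 * (@sin R) ^+ b.+1)); last first.
    by apply/funext => t; rewrite /GRing.mul /= !exprfctE.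
  apply: is_derive_eq; rewrite !exprfctE !exprS.
  rewrite /=; move: (cos x) (sin x) => c s.
  have sE (u v : R) : u *: (v : R^o) = u * v by [].
  by rewrite !sE; ring.
have cF : continuous (fun t : R => b.+1%:R * (cos t ^+ a.+2 * sin t ^+ b) -
     a.+1%:R * (cos t ^+ a * sin t ^+ b.+2)).
  by move=> t; apply: cvgB; exact: continuous_trigZ.
rewrite (Rintegral_is_derive _ _ _ _ (pi_gt0 R) cF dF).
by rewrite sinpi sin0 !(expr0n, mulr0) subrr.
Qed.

Lemma trig_moment1 (b : nat) : trig_moment 1 b = 0.
Proof.
have dF (x : R) : is_derive x (1 : R) (fun t => b.+1%:R^-1 * sin t ^+ b.+1)
    (cos x ^+ 1 * sin x ^+ b).
  rewrite [X in is_derive _ _ X](_ : _ =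
    b.+1%:R^-1 *: (@sin R) ^+ b.+1); last first.
    by apply/funext => t; rewrite /GRing.scale /= exprfctE.
  apply: is_derive_eq; rewrite expr1 /=; move: (cos x) (sin x) => c s.
  have sE (u v : R) : u *: (v : R^o) = u * v by [].
  by rewrite !sE mulrA mulrA mulVf ?mul1r 1?mulrC// pnatr_eq0.
rewrite /trig_moment.
rewrite (Rintegral_is_derive _ _ _ _ (pi_gt0 R) (continuous_trig 1 b) dF).
by rewrite sinpi sin0 !(expr0n, mulr0) subrr.
Qed.

Lemma trig_momentDsin2 (a b : nat) :
  trig_moment a b = trig_moment a.+2 b + trig_moment a b.+2.
Proof.
rewrite /trig_moment -RintegralD//;
  try exact/continuous_integrable_itv/continuous_trig.
apply: eq_Rintegral => t _; rewrite !exprSr.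
transitivity (cos t ^+ a * sin t ^+ b * (cos t ^+ 2 + sin t ^+ 2));
  last by ring.
by rewrite cos2Dsin2 mulr1.
Qed.

(** Integration by parts and [cos ^ 2 + sin ^ 2 = 1] are two linear relations between moments.
    Eliminating the moment with two more sines gives a Wallis recursion. *)
Lemma trig_momentSS (a b : nat) :
  trig_moment a.+2 b = a.+1%:R / (a + b).+2%:R * trig_moment a b.
Proof.
have := trig_moment_parts a b; rewrite (trig_momentDsin2 a b) => E.
have b0 : b.+1%:R != 0 :> R by rewrite pnatr_eq0.
have -> : trig_moment a.+2 b = a.+1%:R / b.+1%:R * trig_moment a b.+2.
  by rewrite mulrAC -E mulrAC divff ?mul1r.
rewrite -!natr1 natrD; field.
by rewrite natr1 b0 /= -natrD !natr1 pnatr_eq0.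
Qed.

Lemma trig_moment0SS (b : nat) :
  trig_moment 0 b.+2 = b.+1%:R / b.+2%:R * trig_moment 0 b.
Proof.
have -> : trig_moment 0 b.+2 = trig_moment 0 b - trig_moment 2 b.
  by rewrite (trig_momentDsin2 0 b) addrAC subrr add0r.
rewrite trig_momentSS add0n; have b2 : b.+2%:R != 0 :> R by rewrite pnatr_eq0.
rewrite -[X in X - _]mul1r -mulrBl; congr (_ * _).
by apply: (mulIf b2); rewrite mulrBl !divfK// mul1r -!natr1; ring.
Qed.

Lemma trig_moment0_gt0 (b : nat) : 0 < trig_moment 0 b.
Proof.
(* The recursion moves by two, so the induction carries two consecutive moments. *)
have : 0 < trig_moment 0 b /\ 0 < trig_moment 0 b.+1; last by case.
elim: b => [|b [b0 b1]]; last first.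
  by split=> //; rewrite trig_moment0SS mulr_gt0// divr_gt0.
split.
  rewrite /trig_moment; under eq_Rintegral do rewrite !expr0 mulr1.
  rewrite Rintegral_cst// mul1r /= lebesgue_measure_itv /= lte_fin pi_gt0.
  by rewrite -EFinB subr0 pi_gt0.
have dF (x : R) : is_derive x (1 : R) (- (@cos R)) (cos x ^+ 0 * sin x ^+ 1).
  by apply: is_derive_eq; rewrite mul1r opprK.
rewrite /trig_moment.
rewrite (Rintegral_is_derive _ _ _ _ (pi_gt0 R) (continuous_trig 0 1) dF).
by rewrite /= !fctE cospi cos0; lra.
Qed.

Lemma trig_moment_odd (a b : nat) : odd a -> trig_moment a b = 0.
Proof.
have [k ->] : exists k, a = (odd a + k.*2)%N.
  by exists a./2; rewrite odd_double_half.
rewrite oddD odd_double addbF oddb => ->; elim: k => [|k IHk].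
  exact: trig_moment1.
by rewrite doubleS !addnS trig_momentSS IHk mulr0.
Qed.

Lemma trig_moment_even (a b : nat) :
  trig_moment a.*2 b =
  trig_moment 0 b * \prod_(i < a) (i.*2.+1%:R / (b + i.*2).+2%:R).
Proof.
elim: a => [|a IHa]; first by rewrite big_ord0 mulr1.
by rewrite doubleS trig_momentSS IHa big_ord_recr /= (addnC b); ring.
Qed.
End TrigMoments.

(** * Integrals against the Gegenbauer weight *)

Section CosSubstitution.
Context {R : realType}.
Notation mu := (@lebesgue_measure R).

(** The compact intervals from [d m] to [pi - d m] will exhaust []0, pi[]. The shift by two keeps
    [d m] at most [pi / 2], so none of them is empty. *)
Let d (m : nat) : R := pi / m.+2%:R.

Let d_gt0 m : 0 < d m.
Proof. by rewrite divr_gt0 ?pi_gt0. Qed.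

Let d_ltpi m : d m < pi.
Proof.
rewrite ltr_pdivrMr// ltr_pMr ?pi_gt0// ltr1n//.
Qed.

Let d_le m : d m <= pi - d m.
Proof.
rewrite lerBrDr -mulr2n -mulr_natr -mulrA mulrC.
by rewrite ger_pMl ?pi_gt0// mulrC ler_pdivrMr// mul1r ler_nat.
Qed.

Let d_nincr m p : (m <= p)%N -> d p <= d m.
Proof.
by move=> mp; rewrite ler_pM2l ?pi_gt0// lef_pV2 ?posrE// ler_nat !ltnS.
Qed.

Let d_small (x : R) : 0 < x -> exists m, d m <= x.
Proof.
move=> x0; have [k] := ltr_add_invr (divr_gt0 x0 (pi_gt0 R)).
rewrite add0r ltr_pdivlMr ?pi_gt0// => kx; exists k; apply: le_trans (ltW kx).
by rewrite /d mulrC ler_pM2r ?pi_gt0// lef_pV2 ?posrE// ler_nat.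
Qed.

Let oo_bigcup : `]0, pi[%classic = \bigcup_m `[d m, pi - d m]%classic :> set R.
Proof.
apply/seteqP; split=> x /=; last first.
  move=> [m _] /=; rewrite !in_itv/= => /andP[dx xd].
  by have := d_gt0 m; rewrite (lt_le_trans (d_gt0 m) dx)/=; lra.
rewrite in_itv/= => /andP[x0 xpi].
have [m dm] := d_small _ x0; have [p dp] : exists p, d p <= pi - x.
  by apply: d_small; lra.
exists (maxn m p) => //=; rewrite in_itv/=.
rewrite (le_trans (d_nincr _ _ (leq_maxl m p)) dm)/=.
by have := d_nincr _ _ (leq_maxr m p); lra.
Qed.

Let cos_mono (x y : R) : 0 <= x <= pi -> 0 <= y <= pi ->
  (cos x <= cos y) = (y <= x).
Proof.
by move=> xp yp; rewrite leNgt ltr_cos ?in_itv// -leNgt.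
Qed.

Let cos_lt (x y : R) : 0 <= x <= pi -> 0 <= y <= pi ->
  (cos x < cos y) = (y < x).
Proof. by move=> xp yp; rewrite ltr_cos ?in_itv. Qed.

Let dpi m : 0 <= d m <= pi.
Proof. by rewrite (ltW (d_gt0 m)) (ltW (d_ltpi m)). Qed.

Let pid m : 0 <= pi - d m <= pi.
Proof. by have := dpi m; lra. Qed.

Let cos_bigcup : `]-1, 1[%classic =
  \bigcup_m `[cos (pi - d m), cos (d m)]%classic :> set R.
Proof.
have pi0 := pi_gt0 R.
apply/seteqP; split=> x /=; last first.
  move=> [m _] /=; rewrite !in_itv/= => /andP[dx xd]; apply/andP; split.
    apply: lt_le_trans dx; rewrite -cospi cos_lt//; last by rewrite ltW/=.
    by have := d_gt0 m; lra.
  by apply: le_lt_trans xd _; rewrite -cos0 cos_lt//= lexx/= ltW.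
rewrite in_itv/= => /andP[x0 x1].
have xI : -1 <= x <= 1 by rewrite !ltW.
have : `]0, pi[%classic (acos x).
  by rewrite /= in_itv/= acos_gt0 ?acos_ltpi ?x0 ?x1 ?ltW.
rewrite oo_bigcup => -[m _] /=; rewrite in_itv/= => /andP[dx xd].
exists m => //=; rewrite in_itv/= -(acosK (x := x)) ?in_itv//.
have aI : 0 <= acos x <= pi by rewrite acos_ge0 ?acos_lepi.
by rewrite !cos_mono// dx xd.
Qed.

(* For n = 2 the weight is singular at -1 and 1, so the open interval is
   exhausted by compact ones. *)
Lemma ge0_integral_cos (G : R -> R) :
    {in `]-1, 1[, continuous G} -> {in `]-1, 1[, forall t, 0 <= G t} ->
  (\int[mu]_(t in `](-1)%R, 1%R[) (G t)%:E =
   \int[mu]_(x in `]0%R, pi[) (G (cos x) * sin x)%:E)%E.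
Proof.
move=> cG G0; rewrite cos_bigcup oo_bigcup.
pose E m : set R := `[cos (pi - d m), cos (d m)]%classic.
pose D m : set R := `[d m, pi - d m]%classic.
have cosI (x : R) : 0 < x < pi -> cos x \in `]-1, 1[.
  move=> /andP[x0 xpi]; have pi0 := ltW (pi_gt0 R).
  by rewrite in_itv/= -cospi -cos0 !cos_lt ?x0 ?xpi ?lexx ?pi0 ?ltW.
have subE m t : E m t -> t \in `]-1, 1[.
  move=> Emt; have -> : (t \in `]-1, 1[) = (`]-1, 1[%classic t) :> Prop by [].
  by rewrite cos_bigcup; exists m.
have subD m t : D m t -> 0 < t < pi.
  rewrite /D /= in_itv/= => /andP[dx xd]; rewrite (lt_le_trans (d_gt0 m) dx)/=.
  by have := d_gt0 m; lra.
pose H x := G (cos x) * sin x.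
have cH t : 0 < t < pi -> {for t, continuous H}.
  move=> x0; apply: cvgM; last exact: continuous_sin.
  apply: (@continuous_comp _ _ _ cos G); first exact: continuous_cos.
  by apply: cG; exact: cosI.
(* On a compact piece [cos] is decreasing, and the minus sign of its derivative is absorbed by the
   reversal of the endpoints. *)
have EDint m : (\int[mu]_(x in E m) (G x)%:E = \int[mu]_(x in D m) (H x)%:E)%E.
  have dcos : (@cos R)^`()%classic = - (@sin R).
    by apply/funext => x; rewrite derive1E derive_val.
  have cNs : continuous (- (@sin R) : R -> R).
    by move=> x; apply: cvgN; exact: continuous_sin.
  rewrite /E integration_by_substitution_decreasing//; rewrite ?dcos.
  - by apply: eq_integral => x _; rewrite opprK.
  - move=> x y; rewrite !in_itv/= => /andP[dx xd] /andP[dy yd] xy.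
    have := dpi m; have := pid m => /andP[? ?] /andP[? ?].
    by rewrite cos_lt//; apply/andP; split; lra.
  - by move=> x _; exact: cNs.
  - by apply/cvg_ex; eexists; apply: cvg_at_right_filter; exact: cNs.
  - by apply/cvg_ex; eexists; apply: cvg_at_left_filter; exact: cNs.
  - split=> [x _||].
    + exact: derivable_cos.
    + by apply: cvg_at_right_filter; exact: continuous_cos.
    + by apply: cvg_at_left_filter; exact: continuous_cos.
  - apply: continuous_in_subspaceT => x /set_mem Ex; exact: cG (subE _ _ Ex).
(* Monotone convergence, which uses the sign of [G], passes to the open intervals on both sides. The
   two sequences agree, hence so do their limits. *)
have cvgE : (\int[mu]_(x in E i) (G x)%:E @[i --> \oo] -->
    \int[mu]_(x in \bigcup_i E i) (G x)%:E)%E.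
  apply: ge0_nondecreasing_set_cvg_integral.
  - move=> m p mp; apply/subsetPset => x; rewrite /E /= !in_itv/=.
    move=> /andP[mx xm]; apply/andP; split.
      apply: le_trans mx; rewrite cos_mono//.
      by have := d_nincr _ _ mp; lra.
    by apply: le_trans xm _; rewrite cos_mono// d_nincr.
  - by move=> i; exact: measurable_itv.
  - move=> i; apply/measurable_EFinP; apply: subspace_continuous_measurable_fun.
      exact: measurable_itv.
    by apply: continuous_in_subspaceT => x /set_mem Ex; exact: cG (subE _ _ Ex).
  - by move=> i x Ex; rewrite lee_fin; exact: G0 (subE _ _ Ex).
have cvgD : (\int[mu]_(x in D i) (H x)%:E @[i --> \oo] -->
    \int[mu]_(x in \bigcup_i D i) (H x)%:E)%E.
  apply: ge0_nondecreasing_set_cvg_integral.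
  - move=> m p mp; apply/subsetPset => x; rewrite /D /= !in_itv/=.
    move=> /andP[mx xm]; have := d_nincr _ _ mp => mp'.
    by apply/andP; split; lra.
  - by move=> i; exact: measurable_itv.
  - move=> i; apply/measurable_EFinP; apply: subspace_continuous_measurable_fun.
      exact: measurable_itv.
    by apply: continuous_in_subspaceT => x /set_mem Ex; exact: cH (subD _ _ Ex).
  - move=> i x Dx; have x0 := subD _ _ Dx; rewrite lee_fin mulr_ge0//.
      exact/G0/cosI.
    exact/ltW/sin_gt0_pi.
have ED : (fun i => \int[mu]_(x in E i) (G x)%:E)%E =
          (fun i => \int[mu]_(x in D i) (H x)%:E)%E by exact/funext.
by rewrite ED in cvgE; exact: (cvg_unique (@ereal_hausdorff R) cvgE cvgD).
Qed.

Lemma measurable_horner_weight (n : nat) (g : {poly R}) (D : set R) :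
  measurable_fun D (fun t : R => g.[t] * gegenbauer_weight n t).
Proof.
apply: measurable_funTS; apply: measurable_funM.
  exact: continuous_measurable_fun (@continuous_horner R g).
apply: (@measurableT_comp _ _ _ _ _ _ (@powR R ^~ ((n%:R - 3) / 2))).
  exact: measurable_powR.
apply: continuous_measurable_fun => t; apply: cvgB; first exact: cvg_cst.
exact: exprn_continuous.
Qed.

(** The weight at [cos x] is [sin x] to the power [n - 3], and the Jacobian adds one factor. For
    [n = 2] that power is negative, hence the detour through real powers and [sin x > 0]. *)
Lemma weight_cos (n : nat) (x : R) : (2 <= n)%N -> 0 < x < pi ->
  gegenbauer_weight n (cos x) * sin x = sin x ^+ n.-2.
Proof.
move=> n2 x0; have s0 := sin_gt0_pi x0.
rewrite /gegenbauer_weight -sin2cos2 -powR_mulrn ?ltW// -powRrM.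
rewrite -[X in _ * X]powRr1 ?ltW// -powRD; last first.
  by rewrite (lt0r_neq0 s0) implybT.
rewrite -powR_mulrn ?ltW//; congr (_ `^ _).
by case: n n2 => [|[|n]]//= _; rewrite -[n.+2]addn2 natrD; field.
Qed.

Lemma continuous_horner_cos (g : {poly R}) (b : nat) :
  continuous (fun x : R => g.[cos x] * sin x ^+ b).
Proof.
move=> x; apply: cvgM.
  apply: (@continuous_comp _ _ _ cos (horner g)); first exact: continuous_cos.
  exact: continuous_horner.
apply: (@continuous_comp _ _ _ sin (fun x => x ^+ b)).
  exact: continuous_sin.
exact: exprn_continuous.
Qed.

Lemma ge0_integral_weight (n : nat) (g : {poly R}) : (2 <= n)%N ->
    (forall t, -1 <= t <= 1 -> 0 <= g.[t]) ->
  (\int[mu]_(t in `[(-1)%R, 1%R]) (g.[t] * gegenbauer_weight n t)%:E =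
   \int[mu]_(x in `[0%R, pi]) (g.[cos x] * sin x ^+ n.-2)%:E)%E.
Proof.
move=> n2 g0; rewrite integral_itv_bndoo; last first.
  by apply/measurable_EFinP; exact: measurable_horner_weight.
rewrite ge0_integral_cos.
- rewrite [RHS]integral_itv_bndoo; last first.
    apply/measurable_EFinP; apply: measurable_funTS.
    by apply: continuous_measurable_fun; exact: continuous_horner_cos.
  by apply: eq_integral => x /set_mem; rewrite /= in_itv/= => x0;
     rewrite -mulrA weight_cos.
- move=> t; rewrite in_itv/= => /andP[t0 t1].
  apply: cvgM; first exact: continuous_horner.
  rewrite (_ : gegenbauer_weight n =
    (@powR R ^~ ((n%:R - 3) / 2)) \o (fun t => 1 - t ^+ 2))//.
  apply: continuous_comp.
    by apply: cvgB; [exact: cvg_cst | exact: exprn_continuous].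
  apply/differentiable_continuous/derivable1_diffP/derivable_powR.
  by rewrite in_itv/= andbT; nra.
- move=> t; rewrite in_itv/= => /andP[t0 t1].
  by rewrite mulr_ge0 ?powR_ge0// g0// !ltW.
Qed.

Lemma integral_weight (n : nat) (g : {poly R}) : (2 <= n)%N ->
  mu.-integrable `[-1, 1] (EFin \o fun t => g.[t] * gegenbauer_weight n t) /\
  \int[mu]_(t in `[-1, 1]) (g.[t] * gegenbauer_weight n t) =
  \int[mu]_(x in `[0, pi]) (g.[cos x] * sin x ^+ n.-2).
Proof.
move=> n2.
have pos (h : {poly R}) : (forall t, -1 <= t <= 1 -> 0 <= h.[t]) ->
    mu.-integrable `[-1, 1] (EFin \o fun t => h.[t] * gegenbauer_weight n t) /\
    \int[mu]_(t in `[-1, 1]) (h.[t] * gegenbauer_weight n t) =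
    \int[mu]_(x in `[0, pi]) (h.[cos x] * sin x ^+ n.-2).
  move=> h0; split; last by rewrite /Rintegral ge0_integral_weight.
  apply/integrableP; split.
    by apply/measurable_EFinP; exact: measurable_horner_weight.
  (* The integrand equals its absolute value, and the substituted integral is finite because its
     integrand is continuous on a compact interval. *)
  rewrite [X in (X < _)%E](_ : _ = \int[mu]_(t in `[(-1)%R, 1%R])
    (h.[t] * gegenbauer_weight n t)%:E)%E.
    rewrite ge0_integral_weight//.
    have /integrable_fin_num :=
      continuous_integrable_itv _ 0 pi (continuous_horner_cos h n.-2).
    by rewrite ltey_eq => ->.
  apply: eq_integral => t /set_mem; rewrite /= in_itv/= => t1.
  by rewrite ger0_norm// mulr_ge0 ?powR_ge0// h0.
(* Subtracting the minimum of [g] on [[-1, 1]] writes [g] as a nonnegative polynomial plus a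
   multiple of 1; the nonnegative case and linearity then suffice. *)
have [c _ cmin] : exists2 c, c \in `[(-1 : R), 1] &
    forall t, t \in `[(-1 : R), 1] -> g.[c] <= g.[t].
  apply: EVT_min; first lra.
  by apply: continuous_subspaceT; exact: continuous_horner.
have [|i1 e1] := pos (g - (g.[c])%:P).
  by move=> t t1; rewrite !hornerE subr_ge0 cmin// in_itv.
have [|i2 e2] := pos 1%:P; first by move=> t _; rewrite hornerC ler01.
have i3 : mu.-integrable `[-1, 1]
    (EFin \o fun t : R => g.[c] * (1%:P.[t] * gegenbauer_weight n t)).
  rewrite (_ : EFin \o _ = fun t => (g.[c])%:E *
    (EFin \o fun t : R => (1%:P.[t] * gegenbauer_weight n t)%R) t)%E.
    by apply: integrableZl => //; exact: measurable_itv.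
  by apply/funext.
have gE : (fun t => g.[t] * gegenbauer_weight n t) = fun t =>
    (g - (g.[c])%:P).[t] * gegenbauer_weight n t +
    g.[c] * (1%:P.[t] * gegenbauer_weight n t).
  by apply/funext => t; rewrite hornerD hornerN !hornerC; ring.
split.
  rewrite gE; apply: (@integrableD _ _ R mu `[-1, 1]%classic _ _ _ i1 i3).
  exact: measurable_itv.
rewrite gE RintegralD// RintegralZl// e1 e2.
rewrite -RintegralZl//; last first.
  exact/continuous_integrable_itv/continuous_horner_cos.
rewrite -RintegralD//.
- by apply: eq_Rintegral => x _; rewrite hornerD hornerN !hornerC; ring.
- exact/continuous_integrable_itv/continuous_horner_cos.
apply: continuous_integrable_itv => x; apply: cvgM; first exact: cvg_cst.
exact: continuous_horner_cos.
Qed.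
End CosSubstitution.

(** * Spherical means of zonal polynomials *)

Section SphereMoments.
Context {R : realType}.
Notation mu := (@lebesgue_measure R).

(* The mean of x_1 ^ d over the sphere S^(n-1). *)
Definition sphere_moment (n d : nat) : R :=
  if odd d then 0 else \prod_(i < d./2) (i.*2.+1%:R / (n + i.*2)%:R).

(** On the sphere of dimension [b + 1], in [b + 2] coordinates, the polar angle has density
    proportional to [sin ^ b]; hence the index [b.+2]. *)
Lemma trig_momentE (a b : nat) :
  trig_moment a b = trig_moment 0 b * sphere_moment b.+2 a :> R.
Proof.
rewrite /sphere_moment; case: ifPn => oa.
  by rewrite trig_moment_odd ?mulr0.
by rewrite -[in LHS](even_halfK oa) trig_moment_even.
Qed.

Lemma sphere_moment_evenS (n i : nat) : sphere_moment n i.+1.*2 =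
  sphere_moment n i.*2 * (i.*2.+1%:R / (n + i.*2)%:R).
Proof. by rewrite /sphere_moment !odd_double !doubleK big_ord_recr. Qed.

(** Passing from [i] to [i + 1] multiplies both sides by [(m - i) / (i + 1)], and at [i = 0] the
    identity is [trig_momentE]. *)
Lemma bin_sphere_moment (q m i : nat) : (i <= m)%N ->
  'C(m.*2, i.*2)%:R * sphere_moment q.+1 i.*2 *
    trig_moment (m - i).*2 (i.*2 + q) =
  'C(m, i)%:R * (trig_moment 0 q * sphere_moment q.+2 m.*2) :> R.
Proof.
elim: i => [_|i IHi im].
  by rewrite !bin0 subn0 /sphere_moment /= big_ord0 !mul1r trig_momentE.
have [k mE] : exists k, m = (i + k.+1)%N by exists (m - i.+1)%N; lia.
move: (IHi (ltnW im)); rewrite sphere_moment_evenS.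
have -> : (m - i)%N = k.+1 by lia.
have -> : (m - i.+1)%N = k by lia.
move: (trig_moment _ _ * _) => A.
(* [B1] and [B2] advance the lower index of ['C(m.*2, i.*2)] by two, [B3] that of ['C(m, i)] by one,
   and [B4] trades two cosines for two sines. *)
have B1 := mul_bin_left m.*2 i.*2; have B2 := mul_bin_left m.*2 i.*2.+1.
have B3 := mul_bin_left m i.
have B4 := @trig_moment_parts R k.*2 (i.*2 + q).
move: B1 B2 B3 B4; rewrite !doubleS !addSn.
have -> : (m.*2 - i.*2 = 2 * k.+1)%N by lia.
have -> : (m.*2 - i.*2.+1 = k.*2.+1)%N by lia.
have -> : (m - i = k.+1)%N by lia.
have -> : (i.*2.+2 = 2 * i.+1)%N by lia.
move=> /(congr1 (fun p => p%:R : R)) + /(congr1 (fun p => p%:R : R)) +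
  /(congr1 (fun p => p%:R : R)).
rewrite !natrM (addnC q).
have nz p : p.+1%:R != 0 :> R by rewrite pnatr_eq0.
move: (nz i.*2) (nz i) (nz k) (nz k.*2) (nz (i.*2 + q)%N).
move: (i.*2.+1%:R : R) (i.+1%:R : R) (k.+1%:R : R) (k.*2.+1%:R : R) => a b c e.
move: ((i.*2 + q).+1%:R : R) ('C(m.*2, i.*2)%:R : R) => u c0.
move: ('C(m.*2, i.*2.+1)%:R : R) ('C(m.*2, 2 * i.+1)%:R : R) => c1 c2.
move: ('C(m, i)%:R : R) ('C(m, i.+1)%:R : R) (sphere_moment _ _) => d0 d1 r.
move: (trig_moment _ _) (trig_moment _ _) => J0 J2.
move=> a0 b0 cn0 e0 u0 E1 E2 E3 E4 E.
have {}E1 : c1 = 2 * c * c0 / a by rewrite -E1 mulrAC divff ?mul1r.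
have {}E2 : c2 = e * c1 / (2 * b).
  by rewrite -E2 mulrAC divff ?mul1r// mulf_neq0.
have {}E3 : d1 = c * d0 / b by rewrite -E3 mulrAC divff ?mul1r.
have {}E4 : J0 = u * J2 / e by rewrite E4 mulrAC divff ?mul1r.
transitivity (c / b * (c0 * r * J2)); last by rewrite E E3; ring.
by rewrite E2 E1 E4; field; rewrite a0 b0 u0 e0.
Qed.

Lemma sum_even (F : nat -> R) (m : nat) : (forall j, odd j -> F j = 0) ->
  \sum_(j < m.*2.+1) F j = \sum_(i < m.+1) F i.*2.
Proof.
move=> F0; elim: m => [|m IHm]; first by rewrite !big_ord1.
rewrite doubleS !(big_ord_recr m.*2.+2) big_ord_recr /= IHm.
rewrite F0 ?addr0 /= ?odd_double//.
by rewrite [RHS]big_ord_recr.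
Qed.

(** This is the induction step on the dimension for one power of [dot x y], with [y0] the first
    coordinate of [y] and [N] the squared norm of the rest. Odd terms vanish, and
    [bin_sphere_moment] turns the even ones into the expansion of a power of [y0 ^+ 2 + N]. *)
Lemma sphere_moment_rec (q d : nat) (y0 N : R) :
  \sum_(j < d.+1) 'C(d, j)%:R * y0 ^+ (d - j) *
    (sphere_moment q.+1 j * N ^+ j./2) * trig_moment (d - j) (j + q) =
  trig_moment 0 q * (sphere_moment q.+2 d * (y0 ^+ 2 + N) ^+ d./2).
Proof.
have [od|ed] := boolP (odd d).
  rewrite [in RHS]/sphere_moment od mul0r mulr0 big1// => -[j /=].
  rewrite ltnS => jd _.
  have [oj|ej] := boolP (odd j).
    by rewrite /sphere_moment oj !(mul0r, mulr0).
  by rewrite trig_moment_odd ?mulr0// oddB// od (negbTE ej).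
rewrite -(even_halfK ed) doubleK; move: d./2 => m.
rewrite (sum_even (fun j => 'C(m.*2, j)%:R * y0 ^+ (m.*2 - j) *
    (sphere_moment q.+1 j * N ^+ j./2) *
    trig_moment (m.*2 - j) (j + q))); last first.
  by move=> j oj; rewrite /sphere_moment oj !(mul0r, mulr0).
rewrite exprDn mulrA mulr_sumr; apply: eq_bigr => -[i /=]; rewrite ltnS => im _.
rewrite doubleK -doubleB -exprM mul2n.
have := bin_sphere_moment q _ _ im => E.
transitivity ('C(m.*2, i.*2)%:R * sphere_moment q.+1 i.*2 *
   trig_moment (m - i).*2 (i.*2 + q) * (y0 ^+ (m - i).*2 * N ^+ i));
  first by ring.
by rewrite E -mulr_natr; ring.
Qed.

Definition sphere_area (n : nat) : R := sphere_integral (fun _ : 'rV[R]_n => 1).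

Lemma sphere_area1 : sphere_area 1 = 2.
Proof. by []. Qed.

Lemma sphere_areaSS (q : nat) :
  sphere_area q.+2 = trig_moment 0 q * sphere_area q.+1.
Proof.
rewrite {1}/sphere_area /= /trig_moment -RintegralZr//; first last.
  exact/continuous_integrable_itv/continuous_trig.
by apply: eq_Rintegral => t _; rewrite expr0 mul1r.
Qed.

Lemma sphere_area_gt0 (n : nat) : (0 < n)%N -> 0 < sphere_area n.
Proof.
case: n => // n _; elim: n => [|n IHn]; first by rewrite sphere_area1.
by rewrite sphere_areaSS mulr_gt0// trig_moment0_gt0.
Qed.

Lemma dot_row_mx (p : nat) (c : R) (z : 'rV[R]_p) (y : 'rV[R]_(1 + p)) :
  dot (row_mx c%:M z) y = c * lsubmx y ord0 ord0 + dot z (rsubmx y).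
Proof.
rewrite /dot big_split_ord /= big_ord1 row_mxEl !mxE eqxx mulr1n.
by congr (_ + _); apply: eq_bigr => i _; rewrite row_mxEr !mxE.
Qed.

Lemma sum_widen (F : nat -> R) (d K : nat) : (d < K)%N ->
    (forall j, (d < j)%N -> F j = 0) ->
  \sum_(j < d.+1) F j = \sum_(j < K) F j.
Proof.
move=> dK F0; rewrite (big_ord_widen _ F dK) big_mkcond /=.
by apply: eq_bigr => j _; rewrite ltnS; case: leqP => // /F0.
Qed.

(* The hyperspherical recursion does not show the rotation invariance of the
   integral; for zonal functions it follows by induction on the dimension. *)
Lemma sphere_integral_zonal (n : nat) (y : 'rV[R]_n.+1) (K : nat)
    (a : nat -> R) :
  sphere_integral (fun x => \sum_(d < K) a d * dot x y ^+ d) =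
  sphere_area n.+1 *
    \sum_(d < K) a d * (sphere_moment n.+1 d * dot y y ^+ d./2).
Proof.
elim: n y a => [|q IHq] y a.
  (* On the two points of the sphere in dimension one, odd powers cancel and even ones double; all
     factors of the moment are then 1. *)
  rewrite /= -big_split /= sphere_area1 mulr_sumr; apply: eq_bigr => d _.
  have dE (c : R) : dot (const_mx c : 'rV[R]_1) y = c * y ord0 ord0.
    by rewrite /dot big_ord1 mxE.
  rewrite !dE mul1r mulN1r exprNn /sphere_moment -signr_odd.
  case: ifPn => od; first by rewrite expr1; ring.
  rewrite big1 => [|i _]; last by rewrite add1n divff// pnatr_eq0.
  rewrite /dot big_ord1 -expr2 -exprM mul2n even_halfK// expr0; ring.
pose y0 := lsubmx (y : 'rV_(1 + q.+1)) ord0 ord0.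
pose y' := rsubmx (y : 'rV_(1 + q.+1)).
have yE : dot y y = y0 ^+ 2 + dot y' y'.
  rewrite -{1}[y](@hsubmxK _ _ 1 q.+1) [X in row_mx X]mx11_scalar dot_row_mx.
  by rewrite expr2.
(* With [c = cos t] and [s = sin t], these are the coefficients of the slice at angle [t] as a
   polynomial in [dot z y']. The slice is again zonal, so the induction hypothesis applies to it. *)
pose b c s j := \sum_(d < K) a d * 'C(d, j)%:R * (c * y0) ^+ (d - j) * s ^+ j.
have zE c s (z : 'rV_q.+1) :
    \sum_(d < K) a d * dot (row_mx c%:M (s *: z) : 'rV_(1 + q.+1)) y ^+ d =
    \sum_(j < K) b c s j * dot z y' ^+ j.
  under [RHS]eq_bigr do rewrite mulr_suml.
  rewrite exchange_big /=; apply: eq_bigr => d _.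
  rewrite dot_row_mx dotZl exprDn mulr_sumr.
  rewrite -(sum_widen (fun j => a d * 'C(d, j)%:R * (c * y0) ^+ (d - j) *
    s ^+ j * dot z y' ^+ j) _ _ (ltn_ord d)); last first.
    by move=> j dj; rewrite bin_small// !(mulr0, mul0r).
  by apply: eq_bigr => j _; rewrite !exprMn -mulr_natr; ring.
have -> : sphere_integral (fun x : 'rV_q.+2 =>
      \sum_(d < K) a d * dot x y ^+ d) =
    \int[mu]_(t in `[0, pi]) (sin t ^+ q * (sphere_area q.+1 *
     \sum_(j < K) b (cos t) (sin t) j *
       (sphere_moment q.+1 j * dot y' y' ^+ j./2))).
  apply: eq_Rintegral => t _; congr (_ * _); rewrite -IHq.
  rewrite (_ : (fun x : 'rV_q.+1 => \sum_(d < K) b (cos t) (sin t) d * _) =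
      fun z : 'rV_q.+1 => \sum_(d < K) a d *
        dot (row_mx (cos t)%:M (sin t *: z) : 'rV_(1 + q.+1)) y ^+ d) //.
  by apply/funext => z; rewrite zE.
(* [C d j] collects what does not depend on the angle, leaving a trigonometric monomial to
   integrate. *)
pose C d j := sphere_area q.+1 * (a d * 'C(d, j)%:R * y0 ^+ (d - j) *
  (sphere_moment q.+1 j * dot y' y' ^+ j./2)).
transitivity (\int[mu]_(t in `[0, pi]) \sum_(d < K) \sum_(j < K)
    C d j * (cos t ^+ (d - j) * sin t ^+ (j + q))).
  apply: eq_Rintegral => t _; rewrite exchange_big /=.
  rewrite mulrCA mulr_sumr mulr_sumr.
  apply: eq_bigr => j _; rewrite /b mulr_suml !mulr_sumr.
  by apply: eq_bigr => d _; rewrite /C exprMn exprD; ring.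
rewrite Rintegral_sum//; last first.
  move=> d; apply: continuous_integrable_itv => t.
  by apply: cvg_big => [|j _]; [exact: add_continuous|exact: continuous_trigZ].
rewrite mulr_sumr; apply: eq_bigr => d _.
rewrite Rintegral_sum//; last first.
  by move=> j; apply: continuous_integrable_itv; exact: continuous_trigZ.
rewrite yE sphere_areaSS.
transitivity (sphere_area q.+1 * (a d * (trig_moment 0 q *
  (sphere_moment q.+2 d * (y0 ^+ 2 + dot y' y') ^+ d./2)))); last by ring.
rewrite -sphere_moment_rec.
rewrite (sum_widen (fun j => 'C(d, j)%:R * y0 ^+ (d - j) *
    (sphere_moment q.+1 j * dot y' y' ^+ j./2) * trig_moment (d - j) (j + q))
    _ _ (ltn_ord d)); last first.
  by move=> j dj; rewrite bin_small// !(mulr0, mul0r).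
rewrite !mulr_sumr; apply: eq_bigr => j _.
rewrite RintegralZl//; last exact/continuous_integrable_itv/continuous_trig.
by rewrite /C /trig_moment; ring.
Qed.

Lemma sphere_mean_zonal (n K : nat) (y : 'rV[R]_n.+1) (g : {poly R}) :
    (size g <= K)%N ->
  sphere_mean (fun x => g.[dot x y]) =
  \sum_(d < K) g`_d * (sphere_moment n.+1 d * dot y y ^+ d./2).
Proof.
move=> gK; rewrite /sphere_mean -[X in _ / X]/(sphere_area n.+1).
rewrite (_ : (fun x => _) = fun x => \sum_(d < K) g`_d * dot x y ^+ d).
  rewrite sphere_integral_zonal mulrAC divff ?mul1r//.
  by rewrite gt_eqF// sphere_area_gt0.
by apply/funext => x; exact: horner_coef_wide.
Qed.

(** The cosine substitution turns monomials into trigonometric moments, which yields the same sum as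
    [sphere_mean_zonal] for a unit vector. *)
Lemma integral_weight_moment (n K : nat) (g : {poly R}) :
    (2 <= n)%N -> (size g <= K)%N ->
  \int[mu]_(t in `[-1, 1]) (g.[t] * gegenbauer_weight n t) =
  trig_moment 0 n.-2 * \sum_(d < K) g`_d * sphere_moment n d.
Proof.
move=> n2 gK; rewrite (integral_weight _ _ n2).2.
transitivity (\int[mu]_(t in `[0, pi])
    \sum_(d < K) g`_d * (cos t ^+ d * sin t ^+ n.-2)).
  apply: eq_Rintegral => t _; rewrite (horner_coef_wide _ gK) mulr_suml.
  by apply: eq_bigr => d _; rewrite mulrA.
rewrite Rintegral_sum//; last first.
  by move=> d; apply: continuous_integrable_itv; exact: continuous_trigZ.
rewrite mulr_sumr; apply: eq_bigr => d _.
rewrite RintegralZl//; last exact/continuous_integrable_itv/continuous_trig.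
rewrite -[X in _ * X]/(trig_moment d n.-2) trig_momentE.
by case: n n2 => [|[|n]]//= _; ring.
Qed.

(* The normalized integral against the weight is the sphere mean of the zonal
   function, so orthogonality leaves only the first Gegenbauer coefficient. *)
Lemma sphere_mean_gegenbauer (n K : nat) (P : nat -> {poly R}) (fc : nat -> R)
    (y : 'rV[R]_n) : (2 <= n)%N -> gegenbauer n P -> dot y y = 1 ->
  sphere_mean (fun x => (\sum_(i < K.+1) fc i *: P i).[dot x y]) = fc 0%N.
Proof.
move=> n2 [sP P1 orthoP] y1; case: n n2 y y1 orthoP => // m n2 y y1 orthoP.
have P0 : P 0%N = 1%:P.
  have e0 : P 0%N = ((P 0%N)`_0)%:P by rewrite -size1_polyC ?sP.
  by have := P1 0%N; rewrite e0 hornerC => ->.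
(* [M] is the zonal mean as a linear functional of the polynomial. It is proportional to the
   weighted integral, so orthogonality to [P 0 = 1] annihilates it on the other [P i]. *)
pose M (g : {poly R}) := \sum_(d < K.+1) g`_d * sphere_moment m.+1 d.
have M0 : M (P 0%N) = 1.
  rewrite /M P0 big_ord_recl big1 => [|i _]; last by rewrite coefC mul0r.
  by rewrite coefC /sphere_moment /= big_ord0 mulr1 addr0.
have Mi (i : nat) : (0 < i <= K)%N -> M (P i) = 0.
  move=> /andP[i0 iK]; have := orthoP i 0%N.
  rewrite -lt0n i0 => /(_ isT); rewrite P0.
  under eq_Rintegral do rewrite hornerC mulr1.
  rewrite (@integral_weight_moment _ K.+1) ?sP// => /eqP.
  by rewrite mulf_eq0 gt_eqF ?trig_moment0_gt0//= => /eqP.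
rewrite (@sphere_mean_zonal _ K.+1); last first.
  apply: leq_trans (size_sum _ _ _) _; apply/bigmax_leqP => i _.
  by apply: leq_trans (size_scale_leq _ _) _; rewrite sP ltnS -ltnS.
transitivity (\sum_(i < K.+1) fc i * M (P i)).
  rewrite /M; under [RHS]eq_bigr do rewrite mulr_sumr.
  rewrite exchange_big /=; apply: eq_bigr => d _.
  rewrite y1 expr1n mulr1 coef_sum mulr_suml.
  by apply: eq_bigr => i _; rewrite coefZ mulrA.
rewrite big_ord_recl M0 mulr1 big1 ?addr0// => i _.
by rewrite Mi ?mulr0//= ltnS.
Qed.

End SphereMoments.

(** * Spherical designs *)

Lemma zonal_mpoly (R : realType) (n K : nat) (g : {poly R}) (y : 'rV[R]_n) :
    (size g <= K)%N ->
  exists p : mpoly n R, (mmeasure mdeg p <= K)%N /\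
    forall x : 'rV[R]_n, meval (x ord0) p = g.[dot x y].
Proof.
move=> gK; pose L : mpoly n R := \sum_(j < n) y ord0 j *: mpolyX R (mnm1 j).
have sL : (mmeasure mdeg L <= 2)%N.
  apply: leq_trans (mmeasure_sum _ _ _ _) _; apply/bigmax_leqP => j _.
  by apply: leq_trans (msizeZ_le _ _) _; rewrite msizeX mdeg1.
have sLX i : (mmeasure mdeg (L ^+ i) <= i.+1)%N.
  elim: i => [|i IHi]; first by rewrite msize1.
  (* Degrees add only for nonzero factors, and [L] vanishes when [y = 0]. *)
  rewrite exprS; have [->|L0] := eqVneq L 0; first by rewrite mul0r mmeasure0.
  rewrite msizeM ?expf_neq0// -subn1 leq_subLR add1n.
  exact: leq_add sL IHi.
exists (\sum_(i < K) g`_i *: L ^+ i); split.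
  apply: leq_trans (mmeasure_sum _ _ _ _) _; apply/bigmax_leqP => i _.
  by apply: leq_trans (msizeZ_le _ _) _; exact: leq_trans (sLX i) _.
move=> x; rewrite (horner_coef_wide _ gK) rmorph_sum /=; apply: eq_bigr => i _.
rewrite mevalZ rmorphXn /= rmorph_sum /=; congr (_ * _ ^+ _).
by apply: eq_bigr => j _; rewrite mevalZ mevalXU mulrC.
Qed.

Lemma size_spanning (R : realType) (n : nat) (T : seq 'rV[R]_n) :
  <<T>>%VS = fullv -> (n <= size T)%N.
Proof. by move=> TV; have := dim_span T; rewrite TV dimvf /dim /= mul1n. Qed.

Section Design.
Context {R : realType} {n tau : nat} {C : {fset 'rV[R]_n}}.
Hypothesis hC : spherical_design tau C.

Lemma design_zonal (g : {poly R}) (y : 'rV[R]_n) : (size g <= tau.+1)%N ->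
  (\sum_(x <- C) g.[dot x y]) / #|` C|%:R = sphere_mean (fun x => g.[dot x y]).
Proof.
case: hC => _ _ desC /(zonal_mpoly _ _ _ _ y)[p [sp pE]].
have := desC p sp.
rewrite (_ : (fun x => _) = fun x => g.[dot x y]); last exact/funext.
by move=> <-; congr (_ / _); apply: eq_bigr => x _; rewrite pE.
Qed.

(** The design averages linear forms exactly, and their mean over the sphere is an odd moment, hence
    zero. *)
Lemma design_dot_sum (v : 'rV[R]_n) : (0 < tau)%N -> (0 < n)%N ->
  \sum_(x <- C) dot x v = 0.
Proof.
move=> tau0 n0; have CV : <<C>>%VS = fullv by case: hC.
have C0 : (0 < #|` C|)%N by apply: leq_trans (size_spanning _ _ _ CV).
have X2 : (size ('X : {poly R}) <= tau.+1)%N by rewrite size_polyX.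
have := design_zonal 'X v X2; under eq_bigr do rewrite hornerX.
case: n n0 v C CV C0 {X2} => // m _ v D _ D0.
rewrite (@sphere_mean_zonal _ _ 2) ?size_polyX// !big_ord_recl big_ord0 /=.
rewrite !coefX /= /sphere_moment /= !mul0r !mulr0 !addr0 => /eqP.
by rewrite mulf_eq0 invr_eq0 pnatr_eq0 (gtn_eqF D0) orbF => /eqP.
Qed.

Lemma rho_le (y : 'rV[R]_n) (h : R) : (exists x, x \in C) -> dot y y = 1 ->
  (forall x, x \in C -> dot x y <= h) -> rho C <= h.
Proof.
move=> [x0 x0C] y1 yh; have Csph : [set` C] `<=` @sphere R n by case: hC.
have Cub z : @sphere R n z -> has_ubound [set dot x z | x in [set` C]].
  move=> z1; exists 1 => _ [x xC <-].
  exact: le_trans (ler_norm _) (dot_sphere_le1 _ _ (Csph _ xC) z1).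
apply: le_trans (_ : sup [set dot x y | x in [set` C]] <= h); last first.
  by apply: ge_sup; [exists (dot x0 y), x0|move=> _ [x xC <-]; exact: yh].
apply: ge_inf; last by exists y.
(* An infimum lies below the elements only of a set bounded below; here any point of [C] supplies
   the bound -1. *)
exists (-1) => _ [z z1 <-].
apply: le_trans (_ : dot x0 z <= _); last first.
  by apply: ub_le_sup; [exact: Cub|exists x0].
by have := dot_sphere_le1 _ _ (Csph _ x0C) z1; rewrite ler_norml => /andP[].
Qed.

(* y and h are the normal vector and the distance to the origin of a facet of
   the convex hull of C. *)
Lemma design_facet : (0 < tau)%N -> (0 < n)%N -> exists (y : 'rV[R]_n) (h : R),
  [/\ dot y y = 1, forall x, x \in C -> dot x y <= h &
      (n <= count (fun x => dot x y == h) C)%N].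
Proof.
move=> tau0 n0; have CV : <<C>>%VS = fullv by case: hC.
have [z [zP /size_spanning]] :=
  exists_polar_vertex C CV (fun v => design_dot_sum v tau0 n0).
rewrite size_filter => nz.
have z0 : 0 < dot z z.
  (* At [z = 0] no constraint is tight, whereas at least [n > 0] of them are. *)
  rewrite lt0r dot_ge0 andbT dot_eq0; apply: contraTneq nz => ->.
  rewrite -ltnNge (eq_count (a2 := pred0)) ?count_pred0// => x.
  by rewrite /= dot0r eq_sym oner_eq0.
pose h := (Num.sqrt (dot z z))^-1.
have h0 : 0 < h by rewrite invr_gt0 sqrtr_gt0.
exists (h *: z), h; split=> [|x xC|].
- by rewrite dotZl dotZr mulrA -expr2 exprVn sqr_sqrtr ?ltW// mulVf// gt_eqF.
- by rewrite dotZr -[leRHS]mulr1 ler_pM2l// zP.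
rewrite (eq_count (a2 := fun x => dot x z == 1))// => x.
by rewrite dotZr -{2}[h]mulr1 (inj_eq (mulfI _))// gt_eqF.
Qed.
End Design.

Theorem theorem5p2 (R : realType) (n tau : nat) (hn : (2 <= n)%N)
  (htau : (1 <= tau)%N)
  (k : nat) (e : bool) (hke : (tau + 1 = 2 * k + e)%N)
  (tFL : R)
  (htFL : largest_root
            (jacobi ((n%:R - 3) / 2) ((n%:R - 3) / 2 + e%:R) k) tFL)
  (P : nat -> {poly R}) (hP : gegenbauer n P)
  (f : {poly R}) (hdeg : (size f <= tau.+1)%N)
  (fc : nat -> R) (hfc : f = \sum_(i < tau.+1) fc i *: P i)
  (hnonneg : forall t : R, -1 <= t -> t <= tFL -> 0 <= f.[t])
  (hincr : forall s t : R, tFL <= s -> s <= t -> t <= 1 -> f.[s] <= f.[t])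
  (C : {fset 'rV[R]_n}) (hC : spherical_design tau C)
  (m_u : R)
  (hmu : largest_root (n%:R *: f - (fc 0%N * #|` C|%:R)%:P) m_u)
  (hmu_tFL : tFL <= m_u) :
  rho C <= m_u.
Proof.
have n0 : (0 < n)%N by apply: ltnW.
have nR : 2 <= n%:R :> R by rewrite ler_nat.
have [y [h [y1 yh nh]]] := design_facet hC htau n0.
(* For [n >= 2] the first Jacobi parameter is at least -1/2 and the second is no smaller, so both
   exceed -1. *)
have tFL1 : -1 <= tFL.
  apply: jacobi_root_geN1 htFL.1; first lra.
  by have := ler0n R e; lra.
have f0 t : -1 <= t <= 1 -> 0 <= f.[t].
  move=> /andP[t0 t1]; have [tF|/ltW tF] := leP t tFL; first exact: hnonneg.
  exact: le_trans (hnonneg _ tFL1 (lexx _)) (hincr _ _ (lexx _) tF t1).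
have [x0 x0C /eqP x0h] : exists2 x, x \in C & dot x y == h.
  by apply/hasP; rewrite has_count; exact: leq_trans n0 nh.
have C0 : #|` C|%:R != 0 :> R.
  by rewrite pnatr_eq0 cardfs_eq0; apply/fset0Pn; exists x0.
have dotI x : x \in C -> -1 <= dot x y <= 1.
  case: hC => Csph _ _ xC; rewrite -ler_norml.
  exact: dot_sphere_le1 (Csph _ xC) y1.
have rhoh : rho C <= h by apply: rho_le hC _ _ _ y1 yh; exists x0.
apply: le_trans rhoh _.
rewrite leNgt; apply/negP => muh.
(* As an inner product of unit vectors, [h] is at most 1, so [m_u] and [h] both lie where [f] is
   increasing. *)
have /andP[_ h1] := dotI _ x0C; rewrite x0h in h1.
have sumE : \sum_(x <- C) f.[dot x y] = fc 0%N * #|` C|%:R.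
  have := design_zonal hC f y hdeg; rewrite {2}hfc.
  by rewrite sphere_mean_gegenbauer// => <-; rewrite divfK.
have sum_ge : n%:R * f.[h] <= fc 0%N * #|` C|%:R.
  rewrite -sumE.
  have fh : 0 <= f.[h] by rewrite -x0h f0// dotI.
  apply: le_trans (_ : (count (fun x => dot x y == h) C)%:R * f.[h] <= _).
    by rewrite ler_wpM2r// ler_nat.
  (* Points on the facet contribute [f.[h]] each, and the others a nonnegative amount. *)
  rewrite (bigID (fun x => dot x y == h)) /= -[leLHS]addr0 lerD//.
    under eq_bigr => x /eqP -> do [].
    by rewrite big_const_seq iter_addr_0 mulr_natl.
  by rewrite big_seq_cond; apply: sumr_ge0 => x /andP[xC _]; rewrite f0// dotI.
have rootE t : root (n%:R *: f - (fc 0%N * #|` C|%:R)%:P) t =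
    (n%:R * f.[t] == fc 0%N * #|` C|%:R).
  by rewrite rootE hornerD hornerN hornerC hornerZ subr_eq0.
case: hmu => [/[!rootE]/eqP muE mumax].
suff : root (n%:R *: f - (fc 0%N * #|` C|%:R)%:P) h.
  by move/mumax; rewrite leNgt muh.
rewrite rootE eq_le sum_ge /= -muE ler_wpM2l ?ler0n//.
exact: hincr hmu_tFL (ltW muh) h1.
Qed.
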